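(* Let $A=(a_{ij})_{n\times n}$ be a real matrix with nonnegative entries, $L=\mathrm{diag}(A\mathbf 1)-A$, $\delta>0$, and let $\boldsymbol{v}=(v_1,\ldots,v_n)^{\mathrm T}$ be a vector with nonnegative entries and $s=\sum_{i=1}^n v_i>0$. Let $$L_0=\begin{pmatrix} L&\mathbf 0\\ \mathbf 0^{\mathrm T}&0\end{pmatrix},\qquad H_{\delta,\boldsymbol{v}}=\delta\begin{pmatrix} I&-\mathbf 1\\ \mathbf 0^{\mathrm T}&0\end{pmatrix}+\begin{pmatrix}0_{n\times n}&\mathbf 0\\ -\boldsymbol{v}^{\mathrm T}&s\end{pmatrix},$$ and let $\boldsymbol{y}(t)=(y_1(t),\ldots,y_{n+1}(t))^{\mathrm T}$ be a solution to the system $\dot{\boldsymbol{y}}(t)=-(L_0+H_{\delta,\boldsymbol{v}})\,\boldsymbol{y}(t)$, $t\ge0$, with initial state $\boldsymbol{y}(0)$ fixed independently of $\delta$. Let $\tilde{\boldsymbol{v}}=\tfrac1s\boldsymbol{v}$ and let $\bar J$ be the normalized matrix of maximum in-forests of the weighted dependency digraph $\Gamma$ of $A$. Then: 1. $\displaystyle\lim_{\delta\to+0}\lim_{t\to\infty}\boldsymbol{y}(t)=\mathbf 1'\big[\tilde{\boldsymbol{v}}^{\mathrm T}\bar J\;\;0\big]\boldsymbol{y}(0)$; 2. if $\boldsymbol{v}=\tfrac sn\mathbf 1$, then $$\lim_{\delta\to+0}\lim_{t\to\infty}\boldsymbol{y}(t)=\mathbf 1'\big[\tfrac1n\mathbf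 1^{\mathrm T}\bar J\;\;0\big]\boldsymbol{y}(0)=\mathbf 1'\,\tfrac1n\sum_{j=1}^n\bar J_{\cdot j}\,y_j(0),$$ where $\bar J_{\cdot j}=\sum_{i=1}^n\bar J_{ij}$.
   Context: $\mathbf 1$ and $\mathbf 0$ are the all-ones and zero column vectors of length $n$, $\mathbf 1'$ is the all-ones column vector of length $n+1$, $I$ is the identity matrix of order $n$, and $\mathrm{diag}(\boldsymbol{u})$ is the diagonal matrix with the entries of $\boldsymbol{u}$ on the diagonal. $[\,\boldsymbol{u}^{\mathrm T}\;\;c\,]$ denotes the row vector of length $n+1$ obtained by appending $c$ to $\boldsymbol{u}^{\mathrm T}$. The weighted dependency digraph $\Gamma$ of $A$ has vertex set $\{1,\ldots,n\}$ and, for every $a_{ij}>0$, an arc $(i,j)$ (from $i$ to $j$) of weight $a_{ij}$. An in-tree (converging tree) with root $r$ is a digraph in which every vertex has a unique directed path to $r$, every vertex other than $r$ has outdegree $1$, and $r$ has outdegree $0$. An in-forest of $\Gamma$ is a spanning subgraph of $\Gamma$ all of whose weakly connected components are in-trees; it is maximum if it has the maximum possible number of arcs among all in-forests of $\Gamma$. The weight of an in-forest is the product of its arc weights (equal to $1$ if there are no arcs). The normalized matrix of maximum in-forests $\bar J=(\bar J_{ij})_{n\times n}$ has as entry $\bar J_{ij}$ the total weight of the maximum in-forests of $\Gamma$ in which $i$ belongs to the tree with root $j$, divided by the total weight of all maximum in-forests of $\Gamma$. (It is known that $\bar J$ coincides with the eigenprojection of $L$ corresponding to the eigenvalue $0$.)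 *)

(* Defs.v *)
From HB Require Import structures.
From mathcomp Require Import all_boot all_order all_algebra.
From mathcomp Require Import all_classical all_reals all_analysis.

Set Implicit Arguments.
Unset Strict Implicit.
Unset Printing Implicit Defensive.

Import Order.TTheory GRing.Theory Num.Theory.
Import numFieldNormedType.Exports.

Local Open Scope ring_scope.

(* A digraph on a finite vertex type T is represented by its set of arcs:
   (x, y) \in F means that there is an arc from x to y; loops are allowed. *)
Section Digraphs.
Variable T : finType.
Implicit Types (F G : {set T * T}) (V : {set T}) (x y r i j : T).

Definition arc_rel F : rel T := [rel x y | (x, y) \in F].

(* x :: p is a (simple) directed path from x to y; p = [::] when x = y. *)
Definition dipath F x y (p : seq T) : bool :=
  [&& path (arc_rel F) x p, last x p == y & uniq (x :: p)].

Definition outdegree F x : nat := #|[set y | (x, y) \in F]|.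

Definition in_tree V F r : Prop :=
  [/\ F \subset finset.setX V V,
      r \in V,
      forall x, x \in V -> exists! p : seq T, dipath F x r p,
      forall x, x \in V -> x != r -> outdegree F x = 1%N &
      outdegree F r = 0%N].

Definition weak_component F x : {set T} :=
  [set y | connect [rel u w | arc_rel F u w || arc_rel F w u] x y].

(* The weakly connected component of x in the spanning subgraph with arc set
   F is an in-tree with root r. *)
Definition in_tree_of F x r : Prop :=
  in_tree (weak_component F x)
    (F :&: finset.setX (weak_component F x) (weak_component F x)) r.

Definition in_forest G F : Prop :=
  F \subset G /\ forall x, exists r, in_tree_of F x r.

Definition max_in_forest G F : Prop :=
  in_forest G F /\ forall F', in_forest G F' -> (#|F'| <= #|F|)%N.

End Digraphs.

Section Model.
Variables (R : realType) (n : nat).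
Implicit Types (A : 'M[R]_n) (v : 'cV[R]_n).

Definition dependency_arcs A : {set 'I_n * 'I_n} := [set e | 0 < A e.1 e.2].

Definition weight A (F : {set 'I_n * 'I_n}) : R := \prod_(e in F) A e.1 e.2.

(* The normalized matrix of maximum in-forests of the dependency digraph. *)
Definition Jbar A : 'M[R]_n :=
  \matrix_(i, j)
    ((\sum_(F : {set 'I_n * 'I_n}
            | `[< max_in_forest (dependency_arcs A) F /\ in_tree_of F i j >])
         weight A F)
     / (\sum_(F : {set 'I_n * 'I_n}
             | `[< max_in_forest (dependency_arcs A) F >]) weight A F)).

Definition laplacian A : 'M[R]_n := diag_mx (A *m const_mx 1)^T - A.

Definition total v : R := \sum_i v i 0.

Definition L0 A : 'M[R]_(n + 1) := block_mx (laplacian A) 0 0 0.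

Definition H (delta : R) v : 'M[R]_(n + 1) :=
  delta *: block_mx 1%:M (- const_mx 1) 0 0
  + block_mx 0 0 (- v^T) (total v)%:M.

End Model.

Local Open Scope classical_set_scope.

(* y' = M y on [0, +oo), with a one-sided derivative at 0. The values of y at
   negative times are irrelevant. *)
Definition solves (R : realType) (m : nat) (M : 'M[R]_m) (y : R -> 'cV[R]_m) :
    Prop :=
  (h^-1 *: (y h - y 0)) @[h --> 0^'+] --> M *m y 0 /\
  forall t : R, 0 < t -> is_derive (t : R) (1 : R) y (M *m y t).

(* lim_(delta -> +0) lim_(t -> oo) y delta t = l, where both limits are
   asserted to exist (the inner one for every delta > 0). *)
Definition iterated_limit (R : realType) (m : nat) (y : R -> R -> 'cV[R]_m)
    (l : 'cV[R]_m) : Prop :=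
  (forall delta : R, 0 < delta -> cvg (y delta t @[t --> +oo])) /\
  lim (y delta t @[t --> +oo]) @[delta --> 0^'+] --> l.

(* Main.v *)
Require Import Defs.
From HB Require Import structures.
From mathcomp Require Import zify ring lra.
From mathcomp Require Import all_boot all_order all_algebra.
From mathcomp Require Import all_classical all_reals all_analysis.
Import Order.TTheory GRing.Theory Num.Theory.
Import numFieldNormedType.Exports.

(** For fixed delta > 0, every vertex i <= n is pulled towards the last
    coordinate at rate delta.  Hence at a pair of coordinates realizing the
    diameter max (y_i - y_j) the difference decreases at relative rate at least
    delta (system_contraction), and a maximum principle (max_principle) makes
    the diameter decay exponentially: the coordinates of y(t) merge
    (consensus).  A row vector p with entries of sum 1 and p (L0 + H) = 0 is
    conserved, p y(t) = p y(0), so the common limit is p y(0)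
    (cvg_consensus_value).

    The vector p is explicit as soon as L + delta I is inverted:
    p = (s + delta)^-1 [v^T J(delta), delta] with
    J(delta) = delta (L + delta I)^-1.  So everything reduces to
    J(delta) --> Jbar as delta --> +0.

    This follows from a form of the matrix forest theorem.  Represent an
    in-forest by the map f sending each vertex to the head of its arc and each
    root to itself; such maps are those for which every vertex eventually
    reaches a fixed point.  With B x x = delta and B x y = a_xy for x <> y, the
    map f has weight prod_x B x (f x), which is delta ^ (number of roots) times
    the weight of the forest.
    Let Q_ij be the total weight of the forests in which i leads to the root j,
    and sigma that of all forests.  Then
    (L + delta I) Q = delta sigma I (resolvent_forest), without determinants:
    row i is proved by grouping the forests according to everything but the
    arc leaving i (forest_entry_redirect, forest_matrix_eq).  Thus
    J(delta) = Q / sigma.  Dividing numerator and denominator by delta ^ m, m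
    being the least number of roots, only the forests with m roots survive in
    the limit; they are the maximum in-forests, because a forest on n vertices
    with k roots has n - k arcs. *)

Set Implicit Arguments.
Unset Strict Implicit.
Unset Printing Implicit Defensive.
Local Open Scope ring_scope.

(** * Forests as maps with fixed points *)

Section ForestMaps.
Context {T : finType}.
Implicit Types (f g : {ffun T -> T}) (x y r i k : T).

(** A root is encoded as a fixed point, so that loops need no separate
    treatment and the parameter delta becomes a diagonal entry. *)
Definition reaches_root (f : T -> T) x r := fconnect f x r && (f r == r).

Definition forest_map f := [forall x, exists r, reaches_root f x r].

Definition redirect f i k : {ffun T -> T} :=
  [ffun x => if x == i then k else f x].

Lemma forest_mapP f :
  reflect (forall x, exists r, reaches_root f x r) (forest_map f).
Proof. by apply: (iffP forallP) => fF x; apply/existsP/fF. Qed.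

Lemma iter_stable (f : T -> T) r m : f r = r -> iter m f r = r.
Proof. by move=> fr; elim: m => //= m ->. Qed.

Lemma reaches_root_inj (f : T -> T) x r r' :
  reaches_root f x r -> reaches_root f x r' -> r = r'.
Proof.
move=> /andP[/iter_findex xr /eqP fr] /andP[/iter_findex xr' /eqP fr'].
set m := findex f x r in xr; set m' := findex f x r' in xr'.
by rewrite -(iter_stable m' fr) -{1}xr -iterD addnC iterD xr' iter_stable.
Qed.

Lemma reaches_root_fix (f : T -> T) x r :
  f x = x -> reaches_root f x r = (r == x).
Proof.
move=> fx; have xx : reaches_root f x x.
  by rewrite /reaches_root connect0 fx eqxx.
by apply/idP/eqP => [/reaches_root_inj/(_ xx)|-> //].
Qed.

Lemma reaches_root_step (f : T -> T) x r :
  reaches_root f (f x) r = reaches_root f x r.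
Proof.
apply/andP/andP => -[xr fr]; split => //.
  exact: connect_trans (fconnect1 _ _) xr.
move/iter_findex: xr; case: (findex f x r) => [|m] /= xr.
  by rewrite xr (eqP fr) connect0.
by rewrite -xr -iterS iterSr; apply: fconnect_iter.
Qed.

Lemma reaches_root_connect (f : T -> T) x y r :
  fconnect f x y -> reaches_root f y r = reaches_root f x r.
Proof.
move=> /iter_findex <-; elim: (findex f x y) => //= m IH.
by rewrite reaches_root_step.
Qed.

Lemma redirect_at f i k : redirect f i k i = k.
Proof. by rewrite ffunE eqxx. Qed.

Lemma redirect_id f i : redirect f i (f i) = f.
Proof. by apply/ffunP => x; rewrite ffunE; case: eqP => [->|]. Qed.

Lemma redirect_fix f i : f i = i -> redirect f i i = f.
Proof. by move=> {2}<-; exact: redirect_id. Qed.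

Lemma redirect_redirect f i k l :
  redirect (redirect f i k) i l = redirect f i l.
Proof. by apply/ffunP => x; rewrite !ffunE; case: eqP. Qed.

Lemma iter_redirect_away f i k x m :
  ~~ fconnect f x i -> iter m (redirect f i k) x = iter m f x.
Proof.
move=> xi; elim: m => //= m ->; rewrite ffunE; case: eqP => // xmi.
by move: xi; rewrite -xmi fconnect_iter.
Qed.

Lemma fconnect_redirect_away f i k x y :
  ~~ fconnect f x i -> fconnect f x y -> fconnect (redirect f i k) x y.
Proof.
move=> xi /iter_findex <-; rewrite -(iter_redirect_away k _ xi).
exact: fconnect_iter.
Qed.

Lemma fconnect_redirect_to f i k x :
  fconnect f x i -> fconnect (redirect f i k) x i.
Proof.
move=> /iter_findex; move: (findex f x i) => m; elim: m x => [|m IH] x /=.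
  by move=> ->; rewrite connect0.
have [-> _|xi] := eqVneq x i; first by rewrite connect0.
rewrite -iterS iterSr => /IH; apply: connect_trans.
by have := fconnect1 (redirect f i k) x; rewrite {2}/redirect ffunE (negPf xi).
Qed.

Lemma fconnect_redirectE f i k x :
  fconnect (redirect f i k) x i = fconnect f x i.
Proof.
apply/idP/idP; last exact: fconnect_redirect_to.
by move=> /(fconnect_redirect_to (f i)); rewrite redirect_redirect redirect_id.
Qed.

(** The orbit of x never meets i, so it does not see the modification. *)
Lemma reaches_root_redirect_away f i k x r :
  ~~ fconnect f x i ->
  reaches_root (redirect f i k) x r = reaches_root f x r.
Proof.
move=> xi.
have sub f' k' : ~~ fconnect f' x i -> reaches_root f' x r ->
    reaches_root (redirect f' i k') x r.
  move=> xi' /andP[xr fr]; rewrite /reaches_root fconnect_redirect_away //=.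
  rewrite ffunE; case: (eqVneq r i) => // ri.
  by move: xi'; rewrite -ri xr.
apply/idP/idP; last exact: sub.
move=> /(sub _ (f i)); rewrite redirect_redirect redirect_id; apply.
by rewrite fconnect_redirectE.
Qed.

Lemma fconnect_root (f : T -> T) i x :
  f i = i -> fconnect f x i = reaches_root f x i.
Proof. by move=> fi; rewrite /reaches_root fi eqxx andbT. Qed.

(** For a forest g in which i is a root: the targets of i that keep the graph
    acyclic, the choice k = i meaning that i stays a root. *)
Definition attachable g i k := (k == i) || ~~ reaches_root g k i.

(** Hanging the tree of i below k sends the vertices of that tree to the root
    of k and leaves the other ones alone. *)
Lemma reaches_root_redirect g i k x r : g i = i -> attachable g i k ->
  reaches_root (redirect g i k) x r =
  reaches_root g (if reaches_root g x i then k else x) r.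
Proof.
move=> gi gik; case: ifPn => xi; last first.
  by rewrite reaches_root_redirect_away // fconnect_root.
rewrite -(reaches_root_connect (x := x) (y := i)); last first.
  by rewrite fconnect_redirectE fconnect_root.
rewrite -reaches_root_step redirect_at.
case/orP: gik => [/eqP->|ki]; first by rewrite redirect_fix.
by rewrite reaches_root_redirect_away // fconnect_root.
Qed.

(** If k lies in the tree of i, the arc from i to k closes a cycle through i,
    and a root reached from i would have to lie on it; being fixed, it would be
    i itself, whereas i is sent to k. *)
Lemma forest_map_redirect g i k : g i = i ->
  forest_map (redirect g i k) = forest_map g && attachable g i k.
Proof.
move=> gi; apply/idP/andP => [/forest_mapP fF|[/forest_mapP gF gik]];
  last first.
  apply/forest_mapP => x.
  have [r xr] := gF (if reaches_root g x i then k else x).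
  by exists r; rewrite reaches_root_redirect.
split.
  apply/forest_mapP => x; have [xi|xi] := boolP (fconnect g x i).
    by exists i; rewrite -fconnect_root.
  have [r] := fF x; rewrite reaches_root_redirect_away // => xr.
  by exists r.
rewrite /attachable; have [//|ki /=] := eqVneq k i.
apply/negP; rewrite -fconnect_root // -(fconnect_redirectE _ _ k) => kki.
have [r ir] := fF i; have /andP[+ /eqP fr] := ir.
have iki : fconnect (redirect g i k) k i by [].
(* Everything reached from i lies on the cycle through i. *)
have cyc m : fconnect (redirect g i k) (iter m (redirect g i k) i) i.
  elim: m => [|m IH]; first exact: connect0.
  move/iter_findex: IH; case: (findex _ _ _) => [|p] /=.
    by move=> ->; rewrite redirect_at.
  move=> mi; set z := iter m _ i in mi *.
  have := fconnect_iter (redirect g i k) p (redirect g i k z).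
  by rewrite -iterSr iterS mi.
move/iter_findex => rE; have /iter_findex := cyc (findex (redirect g i k) i r).
rewrite rE iter_stable // => ri; move: fr; rewrite ri redirect_at => ki'.
by rewrite ki' eqxx in ki.
Qed.

End ForestMaps.

(** * The matrix forest identity *)

Section ForestMatrix.
Context {R : comPzRingType} {T : finType}.
Variable B : T -> T -> R.
Implicit Types (f g : {ffun T -> T}) (i j k : T).

(** Here B carries the weight of an arc off the diagonal and the weight of
    being a root on the diagonal. *)
Definition map_weight f : R := \prod_x B x (f x).

Definition forest_total : R := \sum_(f | forest_map f) map_weight f.

Definition forest_entry i j : R :=
  \sum_(f | forest_map f && reaches_root f i j) map_weight f.

(** In a forest, i belongs to exactly one tree. *)
Lemma forest_row_sum i : \sum_j forest_entry i j = forest_total.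
Proof.
rewrite /forest_total (exchange_big_dep forest_map) /=; last first.
  by move=> j f _ /andP[].
apply: eq_bigr => f fF; have [r ir] := forest_mapP _ fF i.
rewrite (big_pred1 r) // => j; rewrite fF /=.
by apply/idP/eqP => [/reaches_root_inj/(_ ir)|->].
Qed.

(** A map is determined by its value k at i and by its values elsewhere, the
    latter being recorded as the map g that fixes i. *)
Lemma sum_redirect i (P : pred {ffun T -> T}) (F : {ffun T -> T} -> R) :
  \sum_(f | P f) F f =
  \sum_(g : {ffun T -> T} | g i == i)
     \sum_(k | P (redirect g i k)) F (redirect g i k).
Proof.
rewrite pair_big_dep /=.
rewrite (reindex_onto (fun p : {ffun T -> T} * T => redirect p.1 i p.2)
  (fun f => (redirect f i i, f i))) /=; last first.
  by move=> f _; rewrite redirect_redirect redirect_id.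
apply: eq_bigl => -[g k] /=; rewrite redirect_redirect redirect_at andbC.
congr (_ && _); rewrite xpair_eqE eqxx andbT.
by apply/eqP/eqP => [<-|/redirect_fix //]; exact: redirect_at.
Qed.

Definition weight_away i g : R := \prod_(x | x != i) B x (g x).

Lemma map_weight_redirect g i k :
  map_weight (redirect g i k) = B i k * weight_away i g.
Proof.
rewrite /map_weight (bigD1 i) //= redirect_at; congr (_ * _).
by apply: eq_bigr => x xi; rewrite ffunE (negPf xi).
Qed.

Lemma forest_total_redirect i : forest_total =
  \sum_(g : {ffun T -> T} | (g i == i) && forest_map g)
     weight_away i g * \sum_(k | attachable g i k) B i k.
Proof.
rewrite /forest_total (sum_redirect i) big_mkcondr /=.
apply: eq_bigr => g /eqP gi; case: ifP => gF; last first.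
  by rewrite big_pred0 // => k; rewrite forest_map_redirect // gF.
rewrite mulr_sumr; apply: eq_big => [k|k _].
  by rewrite forest_map_redirect // gF.
by rewrite map_weight_redirect mulrC.
Qed.

Lemma forest_entry_redirect i h j : forest_entry h j =
  \sum_(g : {ffun T -> T} | (g i == i) && forest_map g)
     weight_away i g * \sum_(k | attachable g i k)
        B i k * (reaches_root g (if reaches_root g h i then k else h) j)%:R.
Proof.
rewrite /forest_entry (sum_redirect i) big_mkcondr /=.
apply: eq_bigr => g /eqP gi; case: ifP => gF; last first.
  by rewrite big_pred0 // => k; rewrite forest_map_redirect // gF.
rewrite mulr_sumr [RHS]big_mkcond [LHS]big_mkcond; apply: eq_bigr => k _ /=.
rewrite forest_map_redirect // gF /=; case: ifPn => [/andP[gik]|].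
  rewrite reaches_root_redirect // gik map_weight_redirect => ->.
  by rewrite mulr1 mulrC.
case: ifP => //= gik; rewrite reaches_root_redirect // => /negPf ->.
by rewrite mulr0 mulr0.
Qed.

(** Row i of the identity (L + D) Q = D sigma, where D is the diagonal of B and
    L the Laplacian of its off-diagonal part. It holds already for the
    contribution of each forest g in which i is a root. Let X and Y be the sums
    of B i k and of B i k [k leads to j in g] over the attachable k. A target k
    inside the tree of i follows i and contributes Y; a target k outside it
    keeps its root and contributes X [k leads to j]; the products X Y cancel. *)
Lemma forest_matrix_eq i j :
  (\sum_k B i k) * forest_entry i j
    - \sum_(k | k != i) B i k * forest_entry k j
  = (i == j)%:R * B i i * forest_total.
Proof.
rewrite (forest_entry_redirect i i) (forest_total_redirect i) !mulr_sumr.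
under [X in _ - X]eq_bigr do rewrite (forest_entry_redirect i) mulr_sumr.
rewrite exchange_big -sumrB; apply: eq_bigr => g /andP[/eqP gi gF] /=.
set w := weight_away i g; set att := attachable g i.
pose chi k : R := (reaches_root g k j)%:R.
have gii : reaches_root g i i by rewrite reaches_root_fix.
have chi_i : chi i = (i == j)%:R by rewrite /chi reaches_root_fix // eq_sym.
have att_i : att i by rewrite /att /attachable eqxx.
rewrite gii -/(chi _).
set X := \sum_(k | att k) B i k; set Y := \sum_(k | att k) _.
have YE : Y = B i i * chi i + \sum_(k | att k && (k != i)) B i k * chi k.
  by rewrite /Y (bigD1 i).
have aE : \sum_k B i k = X + \sum_(k | ~~ att k) B i k by rewrite (bigID att).
have -> : \sum_(k | k != i) B i k * (w * \sum_(l | att l) B i l *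
      (reaches_root g (if reaches_root g k i then l else k) j)%:R)
    = w * (\sum_(k | att k && (k != i)) B i k * chi k * X
           + \sum_(k | ~~ att k) B i k * Y).
  rewrite (bigID att) /= mulrDr !mulr_sumr; congr (_ + _).
    apply: eq_big => [k|k /andP[ki]]; first by rewrite andbC.
    rewrite {1}/att /attachable (negPf ki) /= => /negPf ->.
    rewrite -mulr_suml -/X -/(chi k); ring.
  apply: eq_big => [k|k /andP[ki]].
    by have [->|//] := eqVneq k i; rewrite att_i.
  rewrite {1}/att /attachable (negPf ki) /= negbK => ->.
  by rewrite -/Y; ring.
rewrite -!mulr_suml aE.
move: YE; set Z := \sum_(k | att k && (k != i)) _ => ->.
rewrite chi_i; ring.
Qed.

End ForestMatrix.

(** * Arc sets of forest maps are the in-forests *)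

Section ForestArcs.
Context {T : finType}.
Implicit Types (f : {ffun T -> T}) (F G : {set T * T}) (x y r : T).

Definition forest_arcs f : {set T * T} :=
  [set e | (f e.1 == e.2) && (e.2 != e.1)].

Lemma forest_arcsE f x y : ((x, y) \in forest_arcs f) = (f x == y) && (y != x).
Proof. by rewrite inE. Qed.

Lemma forest_arcs_inj : injective forest_arcs.
Proof.
move=> f g fg; apply/ffunP => x; move/setP: fg => fg.
have := fg (x, f x); have := fg (x, g x); rewrite !forest_arcsE !eqxx /=.
have [->|gx] := eqVneq (g x) x; last by rewrite andbT => /eqP.
have [->//|fx] := eqVneq (f x) x.
by move=> _ /esym; rewrite andbT => /eqP.
Qed.

(** No arc can be chosen on the way to a vertex without outgoing arcs. *)
Lemma dipath_uniq F r x (p q : seq T) :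
  (forall u w w', (u, w) \in F -> (u, w') \in F -> w = w') ->
  (forall w, (r, w) \notin F) ->
  dipath F x r p -> dipath F x r q -> p = q.
Proof.
move=> Ffun Fr /and3P[+ + _] /and3P[+ + _].
elim: p x q => [|y p IH] x [|z q] //=.
- by move=> _ /eqP-> /andP[/(negP (Fr z))].
- by move=> /andP[xy _] _ _ /eqP xr; rewrite xr in xy; case/negP: (Fr y).
move=> /andP[xy yp] lp /andP[xz zq] lq.
have yz := Ffun _ _ _ xy xz; rewrite -yz in zq lq *.
by rewrite (IH y q).
Qed.

Lemma connect_dipath F x r :
  connect (arc_rel F) x r -> exists p, dipath F x r p.
Proof.
move=> /connectP[p xp ->]; case: (shortenP xp) => p' xp' up' _.
by exists p'; rewrite /dipath xp' eqxx.
Qed.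

Lemma dipath_connect F x r p : dipath F x r p -> connect (arc_rel F) x r.
Proof. by move=> /and3P[xp /eqP<- _]; apply/connectP; exists p. Qed.

Lemma weak_component_refl F x : x \in weak_component F x.
Proof. by rewrite inE connect0. Qed.

Lemma weak_component_arc F x u w : u \in weak_component F x ->
  (u, w) \in F -> w \in weak_component F x.
Proof.
rewrite !inE => xu uw; apply: connect_trans xu (connect1 _).
by apply/orP; left.
Qed.

Lemma fconnect_arcs f F : (forall u w, (u, w) \in F -> f u = w) ->
  forall x y, connect (arc_rel F) x y -> fconnect f x y.
Proof.
move=> Ff; apply: connect_sub => u w /Ff <-; exact: fconnect1.
Qed.

(** Both ends of an arc lead to the same root, hence so does the whole weak
    component. *)
Lemma reaches_root_in_tree f x r : forest_map f ->
  reaches_root f x r -> in_tree_of (forest_arcs f) x r.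
Proof.
move=> fF xr; rewrite /in_tree_of; set V := weak_component _ x.
set F' := _ :&: _.
have F'E u w : (u, w) \in F' = [&& (u, w) \in forest_arcs f, u \in V & w \in V].
  by rewrite finset.in_setI finset.in_setX.
have /andP[_ /eqP fr] := xr.
have Vroot y : y \in V -> reaches_root f y r.
  rewrite inE => /connectP[p + ->]; elim: p x {V F' F'E} xr => //= y' p IH x xr.
  move=> /andP[xy]; apply: IH; move: xy; rewrite /= /arc_rel /= !forest_arcsE.
  case/orP => /andP[/eqP fxy _]; first by rewrite -fxy reaches_root_step.
  by rewrite -reaches_root_step fxy.
have VF' y : y \in V -> f y != y -> (y, f y) \in F'.
  move=> yV fy; rewrite F'E yV; have yfy : (y, f y) \in forest_arcs f.
    by rewrite forest_arcsE eqxx.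
  by rewrite yfy (weak_component_arc yV).
have Vconn y : y \in V -> connect (arc_rel F') y r.
  move=> yV; have /andP[/iter_findex + _] := Vroot y yV.
  move: (findex f y r) => m; elim: m y yV => [y _ /= ->|m IH y yV yr].
    exact: connect0.
  have [fy|fy] := eqVneq (f y) y.
    by move: (Vroot y yV); rewrite reaches_root_fix // => /eqP->.
  have := VF' y yV fy; rewrite F'E => /and3P[_ _ fyV].
  apply: (connect_trans (connect1 (VF' y yV fy))); apply: IH => //.
  by rewrite -iterSr.
have xV : x \in V by apply: weak_component_refl.
have F'_fun u w w' : (u, w) \in F' -> (u, w') \in F' -> w = w'.
  rewrite !F'E !forest_arcsE => /and3P[/andP[/eqP<- _] _ _].
  by move=> /and3P[/andP[/eqP<-]].
have F'r w : (r, w) \notin F'.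
  by rewrite F'E forest_arcsE fr eq_sym; case: eqVneq.
split.
- exact: finset.subsetIr.
- have clos p z : z \in V -> path (arc_rel F') z p -> last z p \in V.
    elim: p z => //= y p IH z zV /andP[zy]; apply: IH.
    by move: zy; rewrite /arc_rel /= F'E => /and3P[].
  have /connectP[p xp ->] := Vconn x xV; exact: clos.
- move=> y yV; have [p yp] := connect_dipath (Vconn y yV).
  by exists p; split=> // q; apply: dipath_uniq yp.
- move=> y yV yr; rewrite /outdegree (_ : [set _ | _] = [set f y]) ?cards1 //.
  have fy : f y != y.
    apply: contra yr => /eqP fy.
    by move: (Vroot y yV); rewrite reaches_root_fix // eq_sym.
  apply/setP => w; rewrite finset.in_set finset.in_set1; apply/idP/eqP => [|->].
    by move=> yw; apply: F'_fun yw (VF' y yV fy).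
  exact: VF'.
- apply/eqP; rewrite cards_eq0; apply/eqP/setP => w.
  by rewrite finset.in_set finset.in_set0 (negPf (F'r w)).
Qed.

Lemma in_tree_reaches_root f x r :
  in_tree_of (forest_arcs f) x r -> reaches_root f x r.
Proof.
rewrite /in_tree_of; set V := weak_component _ x; set F' := _ :&: _.
move=> [_ rV path_r _ out_r].
have F'E u w : (u, w) \in F' = [&& (u, w) \in forest_arcs f, u \in V & w \in V].
  by rewrite finset.in_setI finset.in_setX.
apply/andP; split.
  have [p [/dipath_connect xr _]] := path_r x (weak_component_refl _ x).
  apply: (fconnect_arcs _ xr) => u w.
  by rewrite F'E forest_arcsE => /andP[/andP[/eqP]].
apply: contraT => fr; have rfr : (r, f r) \in forest_arcs f.
  by rewrite forest_arcsE eqxx.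
move/eqP: out_r; rewrite /outdegree cards_eq0 => /eqP/setP/(_ (f r)).
by rewrite finset.in_set finset.in_set0 F'E rfr rV (weak_component_arc rV).
Qed.

Lemma in_tree_ofE f x r : forest_map f ->
  in_tree_of (forest_arcs f) x r <-> reaches_root f x r.
Proof.
move=> fF; split; [exact: in_tree_reaches_root|exact: reaches_root_in_tree].
Qed.

Lemma in_forest_arcs G f : forest_map f ->
  in_forest G (forest_arcs f) <-> forest_arcs f \subset G.
Proof.
move=> fF; split=> [[]//|fG]; split=> // x.
by have [r xr] := forest_mapP _ fF x; exists r; apply/in_tree_ofE.
Qed.

(** An arc leaving x stays in the component of x, so the outdegree of x can be
    read in the whole digraph. *)
Lemma in_tree_outdegree F x r : in_tree_of F x r ->
  #|[set y | (x, y) \in F]| = (x != r).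
Proof.
rewrite /in_tree_of; set V := weak_component _ x; set F' := _ :&: _.
move=> [_ rV _ out out_r].
have xV : x \in V by apply: weak_component_refl.
have -> : [set y | (x, y) \in F] = [set y | (x, y) \in F'].
  apply/setP => y; rewrite [LHS]finset.in_set [RHS]finset.in_set.
  rewrite finset.in_setI finset.in_setX /= xV /=.
  by apply/idP/andP => [xy|[]//]; split=> //; apply: (weak_component_arc xV).
by have [->|xr] := eqVneq x r; [exact: out_r|exact: out].
Qed.

(** The root has no outgoing arc; a loop at another vertex would be its only
    outgoing arc, so that no simple path could leave it. *)
Lemma in_forest_loopless G F x : in_forest G F -> (x, x) \notin F.
Proof.
move=> [_ /(_ x)[r xr]]; apply/negP => xx.
have := in_tree_outdegree xr; have [xr'|xr' /eqP/cards1P[z xz]] := eqVneq x r.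
  by move/eqP; rewrite cards_eq0 => /eqP/setP/(_ x); rewrite !inE xx.
have only y : (x, y) \in F -> y = x.
  move=> xy; have /setP xz' := xz.
  have := xz' x; have := xz' y; rewrite !inE xx xy => /esym/eqP -> /esym/eqP ->.
  by [].
case: xr => _ _ /(_ x (weak_component_refl _ x))[p [+ _]] _ _.
case: p => [|y p] /and3P[/=].
  by move=> _ /eqP/esym/eqP; rewrite eq_sym (negPf xr').
move=> /andP[+ _] _; rewrite /arc_rel /= finset.in_setI => /andP[/only -> _].
by rewrite inE eqxx.
Qed.

(** Without loops and with outdegrees at most 1, F is recovered from the map
    following its arcs. *)
Lemma in_forest_mapP G F : in_forest G F ->
  exists2 f, forest_map f & F = forest_arcs f.
Proof.
move=> GF; have [_ Ftree] := GF.
pose f := [ffun x => odflt x [pick y | (x, y) \in F]].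
have FE : F = forest_arcs f.
  apply/setP => -[x y]; rewrite forest_arcsE ffunE.
  case: pickP => [z xz|xF] /=; last first.
    by rewrite xF; case: eqVneq => //= ->; rewrite eqxx.
  have [r /in_tree_outdegree out] := Ftree x.
  have : (#|[set y | (x, y) \in F]| <= 1)%N by rewrite out leq_b1.
  move/card_le1_eqP => uniq_out.
  apply/idP/andP => [xy|[/eqP<- //]].
  split; first by apply/eqP/uniq_out; rewrite !inE.
  by apply: contraTneq xy => ->; apply: in_forest_loopless GF.
exists f => //; apply/forest_mapP => x; have [r xr] := Ftree x.
by exists r; apply: in_tree_reaches_root; rewrite -FE.
Qed.

Definition forest_roots f := [set x | f x == x].

Lemma forest_arcs_imset f :
  forest_arcs f = (fun x => (x, f x)) @: ~: forest_roots f.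
Proof.
apply/setP => -[x y]; rewrite forest_arcsE; apply/andP/imsetP => [[/eqP<- fx]|].
  by exists x; rewrite ?inE.
by move=> [z + [-> ->]]; rewrite !inE.
Qed.

Lemma card_forest_arcs f : (#|forest_arcs f| + #|forest_roots f|)%N = #|T|.
Proof.
rewrite forest_arcs_imset card_imset; last by move=> x y [].
by rewrite addnC cardsC.
Qed.

Lemma forest_map_id : forest_map [ffun x : T => x].
Proof.
by apply/forest_mapP => x; exists x; rewrite /reaches_root connect0 ffunE eqxx.
Qed.

Definition fits G f := forest_map f && (forest_arcs f \subset G).

(** By card_forest_arcs, maximizing the number of arcs is minimizing the number
    of roots. *)
Lemma min_roots G : exists m,
  [/\ forall f, fits G f -> (m <= #|forest_roots f|)%N,
      exists2 f, fits G f & #|forest_roots f| = m &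
      forall f, forest_map f ->
        max_in_forest G (forest_arcs f) <->
        fits G f /\ #|forest_roots f| = m].
Proof.
have fits_id : fits G [ffun x => x].
  rewrite /fits forest_map_id; apply/fintype.subsetP => -[x y].
  by rewrite forest_arcsE ffunE => /andP[/eqP->]; rewrite eqxx.
case: (arg_minnP (fun f => #|forest_roots f|) fits_id) => f0 f0G f0min.
exists #|forest_roots f0|; split=> //; [by exists f0|move=> f fF].
split=> [[]|[fG fm]].
  move=> /(in_forest_arcs _ fF) fG fmax.
  have fGb : fits G f by rewrite /fits fF.
  split=> //; apply/eqP; rewrite eqn_leq f0min // andbT.
  have /andP[f0F f0G'] := f0G.
  have := fmax _ ((in_forest_arcs G f0F).2 f0G').
  have := card_forest_arcs f; have := card_forest_arcs f0; lia.
split; first by apply/in_forest_arcs => //; case/andP: fG.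
move=> F' GF'; have [f' f'F F'E] := in_forest_mapP GF'.
have /f0min : fits G f'.
  by rewrite /fits f'F -F'E; case: GF'.
rewrite F'E; have := card_forest_arcs f; have := card_forest_arcs f'; lia.
Qed.

End ForestArcs.

(** * The normalized forest weights tend to Jbar *)

Local Open Scope classical_set_scope.
Local Open Scope ring_scope.

Section ForestLimit.
Context {R : realType} {n : nat}.
Variable A : 'M[R]_n.
Implicit Types (d : R) (f : {ffun 'I_n -> 'I_n}) (i j k x y : 'I_n).

Local Notation G := (dependency_arcs A).

Lemma sum_max_in_forest (P : {set 'I_n * 'I_n} -> Prop) :
  \sum_(F | `[< max_in_forest G F /\ P F >]) weight A F =
  \sum_(f | forest_map f &&
            `[< max_in_forest G (forest_arcs f) /\ P (forest_arcs f) >])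
     weight A (forest_arcs f).
Proof.
pose inv F : {ffun 'I_n -> 'I_n} :=
  odflt [ffun x => x] [pick f | forest_map f && (forest_arcs f == F)].
have invK f : forest_map f -> inv (forest_arcs f) = f.
  rewrite /inv => fF; case: pickP => [g /andP[_ /eqP /forest_arcs_inj]//|].
  by move=> /(_ f); rewrite fF eqxx.
rewrite (reindex_onto (@forest_arcs _) inv) /=; last first.
  by move=> F /asboolP[[/in_forest_mapP[f fF ->] _] _]; rewrite invK.
apply: eq_bigl => f; rewrite andbC; apply/andP/andP => -[fF].
  move=> /[dup] /asboolP[[/in_forest_mapP[g gF /forest_arcs_inj fg] _] _].
  by rewrite fg.
by rewrite invK.
Qed.

Definition arc_weight f : R := \prod_(x | f x != x) A x (f x).

Lemma weight_forest_arcs f : weight A (forest_arcs f) = arc_weight f.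
Proof.
rewrite /weight forest_arcs_imset big_imset; last by move=> x y _ _ [].
by apply: eq_bigl => x; rewrite !inE.
Qed.

(** The weights for which forest_matrix_eq concerns L + d I. *)
Definition grounded d x y : R := if x == y then d else A x y.

Lemma map_weight_grounded d f :
  map_weight (grounded d) f = d ^+ #|forest_roots f| * arc_weight f.
Proof.
rewrite /map_weight (bigID [pred x | f x == x]) /=; congr (_ * _).
  rewrite -prodr_const; apply: eq_big => x; first by rewrite inE.
  by move=> /eqP ->; rewrite /grounded eqxx.
by apply: eq_bigr => x; rewrite /grounded eq_sym => /negPf ->.
Qed.

Lemma resolvent_forest d :
  (laplacian A + d%:M) *m (\matrix_(i, j) forest_entry (grounded d) i j)
  = (d * forest_total (grounded d))%:M.
Proof.
apply/matrixP => i j; rewrite !mxE.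
have := forest_matrix_eq (grounded d) i j.
rewrite [grounded d i i]/grounded eqxx => Qij.
rewrite -[RHS]mulr_natl mulrA -Qij.
under eq_bigr => k _ do rewrite !mxE.
rewrite (bigD1 i) //= [X in _ = X * _ - _](bigD1 i) //=.
rewrite [grounded d i i]/grounded !eqxx.
have -> : \sum_(k | k != i) grounded d i k = \sum_(k | k != i) A i k.
  by apply: eq_bigr => k ki; rewrite /grounded eq_sym (negPf ki).
have -> : \sum_k A i k * (const_mx 1 : 'cV_n) k 0
    = A i i + \sum_(k | k != i) A i k.
  rewrite (bigD1 i) //= !mxE mulr1; congr (_ + _).
  by apply: eq_bigr => k _; rewrite mxE mulr1.
rewrite -sumrN; congr (_ + _); first by rewrite !mulr1n; ring.
apply: eq_bigr => k ki.
rewrite [grounded d i k]/grounded eq_sym (negPf ki) !mulr0n; ring.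
Qed.

Hypothesis A_ge0 : forall i j, 0 <= A i j.

Lemma arc_weight_ge0 f : 0 <= arc_weight f.
Proof. by apply: prodr_ge0. Qed.

(** This allows sums over all forest maps, including those that use pairs
    which are not arcs of the dependency digraph. *)
Lemma arc_weight_unfit f : ~~ (forest_arcs f \subset G) -> arc_weight f = 0.
Proof.
move=> /fintype.subsetPn[[x y]].
rewrite forest_arcsE inE /= => /andP[/eqP<- fx].
rewrite -leNgt => Ax; apply/eqP/prodf_eq0; exists x => //.
by rewrite eq_le Ax A_ge0.
Qed.

Lemma arc_weight_fit f : forest_arcs f \subset G -> 0 < arc_weight f.
Proof.
move=> /fintype.subsetP fG; apply: prodr_gt0 => x fx.
by have := fG (x, f x); rewrite forest_arcsE eqxx inE; apply.
Qed.

(** The forest without arcs already contributes d ^ n. *)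
Lemma forest_total_gt0 d : 0 < d -> 0 < forest_total (grounded d).
Proof.
move=> d0; rewrite /forest_total (bigD1 [ffun x => x]) ?forest_map_id //=.
apply: ltr_wpDr.
  apply: sumr_ge0 => f _.
  rewrite map_weight_grounded mulr_ge0 ?arc_weight_ge0 //.
  by rewrite exprn_ge0 // ltW.
rewrite map_weight_grounded mulr_gt0 ?exprn_gt0 //.
rewrite /arc_weight big_pred0 // => x.
by rewrite ffunE eqxx.
Qed.

(** Both sums are d ^ m times polynomials in d, m being the least number of
    roots; the constant terms of these polynomials are the sums over the
    maximum in-forests, and that of the denominator is positive. *)
Lemma cvg_normalized_forests i j :
  forest_entry (grounded d) i j / forest_total (grounded d) @[d --> 0^'+]
    --> Jbar A i j.
Proof.
have [m [m_min [f0 f0G f0m] m_max]] := min_roots G.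
(* N P d is a forest sum divided by d ^+ m; its value at 0 keeps the forests
   with exactly m roots, since 0 ^+ 0 = 1. *)
pose N (P : pred {ffun 'I_n -> 'I_n}) d :=
  \sum_(f | fits G f && P f) d ^+ (#|forest_roots f| - m)%N * arc_weight f.
have scaleE (P : pred _) d :
    \sum_(f | forest_map f && P f) map_weight (grounded d) f = d ^+ m * N P d.
  rewrite /N mulr_sumr (bigID [pred f : {ffun _} | forest_arcs f \subset G]) /=.
  rewrite [X in _ + X]big1 ?addr0; last first.
    move=> f /andP[_ fG].
    by rewrite map_weight_grounded arc_weight_unfit ?mulr0.
  apply: eq_big => f; first by rewrite /fits andbAC.
  move=> /andP[/andP[fF _] fG].
  rewrite map_weight_grounded mulrA -exprD subnKC //.
  by apply: m_min; rewrite /fits fF.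
have N0 (P : pred _) : N P 0 =
    \sum_(f | forest_map f && `[< max_in_forest G (forest_arcs f) /\ P f >])
       weight A (forest_arcs f).
  rewrite /N (bigID [pred f : {ffun _} | #|forest_roots f| == m]) /=.
  rewrite [X in _ + X]big1 ?addr0; last first.
    move=> f /andP[/andP[fG _] fm]; rewrite expr0n subn_eq0 leqNgt.
    by rewrite ltn_neqAle eq_sym fm m_min //= mul0r.
  apply: eq_big => f; last first.
    by move=> /andP[_ /eqP ->]; rewrite subnn expr0 mul1r weight_forest_arcs.
  apply/andP/andP => [[/andP[fG Pf] /eqP fm]|];
    last move=> [fF /asboolP[/(m_max _ fF)[fG fm] Pf]].
    have fF : forest_map f by case/andP: fG.
    by split=> //; apply/asboolP; split=> //; apply/(m_max _ fF).
  by rewrite fG Pf fm eqxx.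
have N_cvg P : N P d @[d --> 0^'+] --> N P 0.
  apply: cvg_at_right_filter; apply: (cvg_big (@add_continuous _)) => f _.
  by apply: cvgM; [exact: exprn_continuous|exact: cvg_cst].
have N0_gt0 : 0 < N predT 0.
  rewrite /N (bigD1 f0) ?f0G //= f0m subnn expr0 mul1r ltr_wpDr //.
    by apply: sumr_ge0 => f _; rewrite mulr_ge0 ?exprn_ge0 ?arc_weight_ge0.
  by apply: arc_weight_fit; case/andP: f0G.
have JE : Jbar A i j = N (fun f => reaches_root f i j) 0 / N predT 0.
  rewrite mxE; congr (_ / _); last first.
    rewrite N0 /= -(sum_max_in_forest (fun=> true)); apply: eq_bigl => F.
    by apply: asbool_equiv_eq; split=> [|[]].
  rewrite N0 sum_max_in_forest; apply: eq_bigl => f.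
  have [fF /=|//] := boolP (forest_map f); apply: asbool_equiv_eq.
  by split=> -[fmax /(in_tree_ofE _ _ fF)].
rewrite JE; apply: cvg_trans (cvgM (N_cvg _) (cvgV _ (N_cvg predT))).
  apply: near_eq_cvg; near=> d.
  rewrite /forest_entry scaleE /forest_total.
  under [X in _ = _ / X]eq_bigl do rewrite -[forest_map _]andbT.
  rewrite (scaleE predT) -mulf_div divff ?mul1r //.
  by rewrite expf_neq0 // gt_eqF //; near: d; exact: nbhs_right_gt.
by rewrite gt_eqF.
Unshelve. all: by end_near. Qed.

End ForestLimit.

(** * Maximum principle and consensus for linear systems *)

Lemma cvg_mx_entries (K : numFieldType) (T : Type) (F : set_system T) m n
    (f : T -> 'M[K]_(m, n)) (l : 'M[K]_(m, n)) : Filter F ->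
  (forall i j, f x i j @[x --> F] --> l i j) -> f x @[x --> F] --> l.
Proof.
move=> FF fl; apply/cvg_ballP => e e0.
have : \forall x \near F, forall i j, ball (l i j) e (f x i j).
  apply: filter_forall => i; apply: filter_forall => j.
  by move/cvg_ballP : (fl i j); apply.
by apply: filterS => x xl; split.
Qed.

Section HalfLine.
Context {R : realType}.
Implicit Types (f df : R -> R) (t T : R).

(** What a maximum principle on the half-line needs: right continuity at 0 and
    a derivative at positive times. *)
Definition derives_to f df : Prop :=
  f h @[h --> 0^'+] --> f 0 /\ forall t, 0 < t -> is_derive t 1 f (df t).

Lemma derives_to_continuous f df T :
  derives_to f df -> {within `[0, T], continuous f}.
Proof.
move=> [f0 fd].
have : {within `[0, +oo[, continuous f}.
  apply: derivable_oy_Rcontinuous_within_itvcy; split=> // t.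
  by rewrite in_itv /= andbT => /fd [].
by apply: continuous_subspaceW; apply: subset_itv; rewrite bnd_simp.
Qed.

Lemma derives_toB f df g dg : derives_to f df -> derives_to g dg ->
  derives_to (fun t => f t - g t) (fun t => df t - dg t).
Proof.
move=> [f0 fd] [g0 gd]; split; first exact: cvgB.
by move=> t t0; have := fd t t0; have := gd t t0 => ? ?; exact: is_deriveB.
Qed.

Lemma derives_to_sum n (c : 'I_n -> R) (f df : 'I_n -> R -> R) :
  (forall i, derives_to (f i) (df i)) ->
  derives_to (fun t => \sum_i c i * f i t) (fun t => \sum_i c i * df i t).
Proof.
move=> fd; split.
  apply: (cvg_big (@add_continuous _)) => i _.
  by apply: cvgM; [exact: cvg_cst|case: (fd i)].
move=> t t0; rewrite (_ : (fun _ => _) = \sum_(i < n) c i \*: f i); last first.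
  by apply/funext => u; rewrite fct_sumE.
by apply: is_derive_sum => i; exact: (is_deriveZ (c i) ((fd i).2 t t0)).
Qed.

Lemma derives_to_expM a f df : derives_to f df ->
  derives_to (fun t => expR (a * t) * f t)
             (fun t => expR (a * t) * (a * f t + df t)).
Proof.
move=> [f0 fd]; split.
  apply: cvgM => //; apply: cvg_at_right_filter.
  apply: continuous_comp; last exact: continuous_expR.
  by apply: cvgM; [exact: cvg_cst|exact: cvg_id].
move=> t t0; have fdt := fd t t0.
have ed : is_derive t 1 (fun u => expR (a * u)) (expR (a * t) * a).
  apply: (@is_derive1_comp _ expR ( *%R a)) => //.
  have := is_deriveZ a (is_derive_id t (1 : R)).
  by rewrite /GRing.scale /= mulr1.
apply: (is_derive_eq (is_deriveM ed fdt)); rewrite /GRing.scale /=; ring.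
Qed.

(** The difference quotients from the left are nonnegative. *)
Lemma left_max_derive f (c d : R) : 0 < c -> is_derive c 1 f d ->
  (forall t, 0 <= t <= c -> f t <= f c) -> 0 <= d.
Proof.
move=> c0 fd fmax.
have quot : (h^-1 *: (f (h *: 1 + c) - f c)) @[h --> 0^'] --> d.
  by have [/derivableP[_]] := fd; have [dvb <-] := fd.
have quotL := cvg_dnbhs_at_left quot.
rewrite -(cvg_lim _ quotL) //; apply: limr_ge; first by apply/cvg_ex; exists d.
near=> h.
have h0 : h < 0 by near: h; exact: nbhs_left_lt.
rewrite /GRing.scale /= mulr1; apply: mulr_le0; first by rewrite invr_le0 ltW.
rewrite subr_le0; apply: fmax; rewrite gerDr (ltW h0) andbT.
rewrite -lerBlDr sub0r; near: h; apply: nbhs_left_ge; lra.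
Unshelve. all: by end_near. Qed.

Lemma derives_to0_const f t : derives_to f (fun=> 0) -> 0 <= t -> f t = f 0.
Proof.
move=> fd; rewrite le_eqVlt => /predU1P[<-//|t0].
have [||u _ /eqP] := @MVT _ f (fun=> 0) _ _ t0.
- by move=> u; rewrite in_itv /= => /andP[u0 _]; case: fd => _; apply.
- exact: derives_to_continuous fd.
by rewrite mul0r subr_eq0 => /eqP.
Qed.

(** On [0, t] take the largest value reached by any member of the family. If it
    exceeds C it is reached at a positive time by a member which is then
    maximal in the family and maximal in the past, so that its derivative is
    both negative and nonnegative. *)
Lemma max_principle (I : finType) (f df : I -> R -> R) (C : R) :
  0 <= C -> (forall k, derives_to (f k) (df k)) -> (forall k, f k 0 <= C) ->
  (forall k t, 0 < t -> 0 < f k t -> (forall l, f l t <= f k t) ->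
     df k t < 0) ->
  forall k t, 0 <= t -> f k t <= C.
Proof.
move=> C0 fd f0 decr k t t0; rewrite leNgt; apply/negP => fkt.
have : forall l, exists c,
    0 <= c <= t /\ forall u, 0 <= u <= t -> f l u <= f l c.
  move=> l.
  have [c ct cmax] := EVT_max t0 (derives_to_continuous (T := t) (fd l)).
  by exists c; split=> [|u ut]; [move: ct|apply: cmax]; rewrite in_itv.
move=> /choice[c c_max].
case: (@Order.TotalTheory.arg_maxP _ _ _ k predT (fun l => f l (c l)) isT).
move=> l _ l_max; have [/andP[c0 ct] cl] := c_max l.
have Cl : C < f l (c l).
  apply: lt_le_trans fkt (le_trans _ (l_max k isT)).
  by have [_] := c_max k; apply; rewrite t0 lexx.
have {}c0 : 0 < c l.
  rewrite lt_neqAle c0 andbT; apply: contraTneq Cl => <-.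
  by rewrite -leNgt f0.
have : df l (c l) < 0.
  apply: decr => //; first exact: le_lt_trans Cl.
  move=> j; apply: le_trans (l_max j isT).
  by have [_] := c_max j; apply; rewrite (ltW c0).
rewrite ltNge => /negP; apply; have [_ fdl] := fd l.
apply: left_max_derive (fdl _ c0) _ => // u /andP[u0 uc].
by apply: cl; rewrite u0 (le_trans uc).
Qed.

End HalfLine.

Section Consensus.
Context {R : realType} {m : nat}.
Variables (W : 'M[R]_m) (y : R -> 'cV[R]_m).
Hypothesis y_sol : solves W y.

Lemma solves_coord i :
  derives_to (fun t => y t i 0) (fun t => (W *m y t) i 0).
Proof.
have [y_0 y_d] := y_sol; split; last first.
  move=> t /y_d[yt yE]; have /derivable_mxP yti := yt.
  by split; [exact: yti|rewrite -yE derive_mx // mxE].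
have y0 : y h @[h --> 0^'+] --> y 0.
  have : (y 0 + h *: (h^-1 *: (y h - y 0))) @[h --> 0^'+]
      --> y 0 + 0 *: (W *m y 0).
    apply: cvgD; first exact: cvg_cst.
    by apply: cvgZ => //; apply: cvg_at_right_filter; exact: cvg_id.
  rewrite scale0r addr0; apply: cvg_trans; apply: near_eq_cvg; near=> h.
  by rewrite scalerA divff ?scale1r ?subrKC.
exact: (cvg_comp _ _ y0 (@coord_continuous R m 1 i 0 (y 0))).
Unshelve. all: by end_near. Qed.

(** The maximum principle is applied to exp (a t / 2) (y_i - y_j). Giving up
    half of the rate a makes the derivative strictly negative at a positive
    maximum. *)
Lemma consensus (a : R) : 0 < a ->
  (forall (z : 'cV_m) i j, (forall k l, z k 0 - z l 0 <= z i 0 - z j 0) ->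
     (W *m z) i 0 - (W *m z) j 0 <= - a * (z i 0 - z j 0)) ->
  forall i j, y t i 0 - y t j 0 @[t --> +oo] --> 0.
Proof.
move=> a0 contract.
pose f (k : 'I_m * 'I_m) t := expR (a / 2 * t) * (y t k.1 0 - y t k.2 0).
pose C := \sum_(k : 'I_m * 'I_m) `|f k 0|.
have C0 : 0 <= C by apply: sumr_ge0.
have fd k := derives_to_expM (a / 2)
  (derives_toB (solves_coord k.1) (solves_coord k.2)).
have bound k t : 0 <= t -> f k t <= C.
  apply: (max_principle C0 fd) => {k t} [k|k t t0].
    rewrite -/(f k 0) /C (bigD1 k) //= (le_trans (ler_norm _)) // lerDl.
    exact: sumr_ge0.
  rewrite pmulr_rgt0 ?expR_gt0 // => dk kmax.
  rewrite pmulr_rlt0 ?expR_gt0 //.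
  have := contract (y t) k.1 k.2.
  have le u v : y t u 0 - y t v 0 <= y t k.1 0 - y t k.2 0.
    by have := kmax (u, v); rewrite /= ler_pM2l ?expR_gt0.
  by move=> /(_ le); move: dk; set D := _ - _; set D' := _ - _; nra.
have dist i j t : 0 <= t -> y t i 0 - y t j 0 <= C * expR (- (a / 2 * t)).
  move=> t0; rewrite expRN ler_pdivlMr ?expR_gt0 // mulrC.
  exact: (bound (i, j)).
have decay : C * expR (- (a / 2 * t)) @[t --> +oo] --> 0.
  rewrite -(mulr0 C); apply: cvgM; first exact: cvg_cst.
  apply: (cvg_comp (fun t => a / 2 * t) (fun u => expR (- u)) _ (@cvgr_expR R)).
  by apply: gt0_cvgMry; [lra|exact: cvg_id].
move=> i j; apply: (squeeze_cvgr _ _ decay); last first.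
  by rewrite -[0]oppr0; apply: cvgN; exact: decay.
near=> t; have t0 : 0 <= t by near: t; exact: nbhs_pinfty_ge.
by rewrite dist // lerNl opprB dist.
Unshelve. all: by end_near. Qed.

(** As p W = 0, the number p y(t) is constant; as the entries of p sum to 1, it
    differs from y_i(t) by a combination of differences of coordinates. *)
Lemma cvg_consensus_value (a : R) (p : 'rV[R]_m) : 0 < a ->
  (forall (z : 'cV_m) i j, (forall k l, z k 0 - z l 0 <= z i 0 - z j 0) ->
     (W *m z) i 0 - (W *m z) j 0 <= - a * (z i 0 - z j 0)) ->
  p *m W = 0 -> p *m (const_mx 1 : 'cV_m) = 1%:M ->
  y t @[t --> +oo] --> (const_mx 1 : 'cV_m) *m p *m y 0.
Proof.
move=> a0 contract pW p1; apply: cvg_mx_entries => i j; rewrite (ord1 j) {j}.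
have sum_p : \sum_k p 0 k = 1.
  have /matrixP/(_ 0 0) := p1; rewrite !mxE; apply: etrans.
  by apply: eq_bigr => k _; rewrite mxE mulr1.
have const t : 0 <= t -> \sum_k p 0 k * y t k 0 = \sum_k p 0 k * y 0 k 0.
  apply: (@derives_to0_const _ (fun t => \sum_k p 0 k * y t k 0)).
  have := derives_to_sum (p 0) solves_coord.
  congr (derives_to _ _); apply/funext => u.
  transitivity ((p *m (W *m y u)) 0 0); first by rewrite mxE.
  by rewrite mulmxA pW mul0mx mxE.
have -> : (const_mx 1 *m p *m y 0) i 0 = \sum_k p 0 k * y 0 k 0.
  rewrite mxE; apply: eq_bigr => k _; congr (_ * _).
  by rewrite mxE big_ord1 mxE mul1r.
set c := (X in _ --> X).
have : (c + \sum_k p 0 k * (y t i 0 - y t k 0)) @[t --> +oo]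
    --> c + \sum_k p 0 k * 0.
  apply: cvgD; first exact: cvg_cst.
  apply: (cvg_big (@add_continuous _)) => k _.
  by apply: cvgM; [exact: cvg_cst|exact: (consensus a0 contract)].
rewrite big1 ?addr0 => [|k _]; last by rewrite mulr0.
apply: cvg_trans; apply: near_eq_cvg; near=> t.
under eq_bigr do rewrite mulrBr.
rewrite sumrB -mulr_suml sum_p mul1r const; first by rewrite addrC subrK.
by near: t; exact: nbhs_pinfty_ge.
Unshelve. all: by end_near. Qed.

End Consensus.

(** * The regularized system *)

Lemma cvg_mulmx (K : numFieldType) (T : Type) (F : set_system T)
    {FF : Filter F} m n p
    (f : T -> 'M[K]_(m, n)) (g : T -> 'M[K]_(n, p))
    (a : 'M[K]_(m, n)) (b : 'M[K]_(n, p)) :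
  f x @[x --> F] --> a -> g x @[x --> F] --> b ->
  f x *m g x @[x --> F] --> a *m b.
Proof.
move=> fa gb; apply: cvg_mx_entries => i j; rewrite mxE.
under eq_cvg do rewrite mxE.
apply: (cvg_big (@add_continuous _)) => k _; apply: cvgM.
  exact: (cvg_comp _ _ fa (@coord_continuous K m n i k a)).
exact: (cvg_comp _ _ gb (@coord_continuous K n p k j b)).
Qed.

Section Regularized.
Context {R : realType} {n : nat}.
Variables (A : 'M[R]_n) (v : 'cV[R]_n).
Hypothesis A_ge0 : forall i j, 0 <= A i j.
Hypothesis v_ge0 : forall i, 0 <= v i 0.

Local Notation s := (Defs.total v).
Hypothesis s_gt0 : 0 < s.

(** This is d (L + d I)^-1, by forest_ratio_resolvent. *)
Definition forest_ratio d : 'M[R]_n :=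
  (forest_total (grounded A d))^-1
    *: \matrix_(i, j) forest_entry (grounded A d) i j.

Lemma forest_ratio1 d : 0 < d ->
  forest_ratio d *m const_mx 1 = const_mx 1 :> 'cV_n.
Proof.
move=> d0; apply/matrixP => i j; rewrite !mxE.
under eq_bigr do rewrite !mxE mulr1.
rewrite -mulr_sumr forest_row_sum mulVf //.
by rewrite gt_eqF // forest_total_gt0.
Qed.

(** The forest identity gives a right inverse; for square matrices it is also a
    left inverse, which is what the left null vector needs. *)
Lemma forest_ratio_resolvent d : 0 < d ->
  forest_ratio d *m (laplacian A + d%:M) = d%:M.
Proof.
move=> d0; have d_neq0 : d != 0 by rewrite gt_eqF.
have right_inv : (laplacian A + d%:M) *m (d^-1 *: forest_ratio d) = 1%:M.
  rewrite -!scalemxAr resolvent_forest scale_scalar_mx mulrCA.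
  rewrite mulVf ?mulr1; last first.
    by rewrite gt_eqF // forest_total_gt0.
  by rewrite scale_scalar_mx mulVf.
have := mulmx1C right_inv; rewrite -scalemxAl => /(congr1 ( *:%R d)).
by rewrite scalerA divff // scale1r scale_scalar_mx mulr1.
Qed.

Lemma system_matrixE d : L0 A + H d v =
  block_mx (laplacian A + d%:M) (- (d *: const_mx 1)) (- v^T) s%:M.
Proof.
rewrite /L0 /H scale_block_mx !add_block_mx scale_scalar_mx mulr1.
by rewrite !scaler0 !add0r !addr0 scalerN.
Qed.

(** The left null vector of the system matrix with entries of sum 1. *)
Definition consensus_weights d : 'rV[R]_(n + 1) :=
  (s + d)^-1 *: row_mx (v^T *m forest_ratio d) (d%:M : 'M[R]_1).

Lemma tr_mul_const1 : v^T *m const_mx 1 = s%:M :> 'M[R]_1.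
Proof.
apply/matrixP => i j; rewrite !ord1 !mxE.
by apply: eq_bigr => k _; rewrite !mxE mulr1.
Qed.

Lemma consensus_weights_stationary d : 0 < d ->
  consensus_weights d *m - (L0 A + H d v) = 0.
Proof.
move=> d0; rewrite system_matrixE mulmxN -scalemxAl mul_row_block.
rewrite -mulmxA forest_ratio_resolvent // !mulmxN -scalemxAr -mulmxA.
rewrite forest_ratio1 // tr_mul_const1 mul_mx_scalar mul_scalar_mx subrr.
rewrite -scalar_mxM scale_scalar_mx addNr.
by rewrite row_mx0 scaler0 oppr0.
Qed.

Lemma consensus_weights1 d : 0 < d ->
  consensus_weights d *m const_mx 1 = 1%:M.
Proof.
move=> d0; rewrite -col_mx_const -scalemxAl mul_row_col -mulmxA.
rewrite forest_ratio1 // tr_mul_const1 mul_scalar_mx.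
rewrite (_ : const_mx 1 = 1%:M :> 'M[R]_1); last first.
  by apply/matrixP => i j; rewrite !ord1 !mxE.
rewrite scale_scalar_mx mulr1 -raddfD /= scale_scalar_mx mulVf //.
by rewrite gt_eqF // addr_gt0.
Qed.

Lemma laplacian_mulE (x : 'cV[R]_n) i :
  (laplacian A *m x) i 0 = \sum_k A i k * (x i 0 - x k 0).
Proof.
rewrite /laplacian mulmxBl mul_diag_mx !mxE.
under [RHS]eq_bigr do rewrite mulrBr.
rewrite sumrB -mulr_suml; congr (_ * _ - _).
by apply: eq_bigr => k _; rewrite mxE mulr1.
Qed.

Lemma system_matrix_mul_l d (z : 'cV[R]_(n + 1)) i :
  (- (L0 A + H d v) *m z) (lshift 1 i) 0 =
  \sum_k A i k * (z (lshift 1 k) 0 - z (lshift 1 i) 0)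
    - d * (z (lshift 1 i) 0 - z (rshift n 0) 0).
Proof.
rewrite system_matrixE -{1}[z]vsubmxK mulNmx mul_block_col.
rewrite mulmxDl mul_scalar_mx mxE col_mxEu.
have addE (a b : 'cV[R]_n) : (a + b) i 0 = a i 0 + b i 0 by rewrite mxE.
rewrite !addE laplacian_mulE.
rewrite !mxE big_ord1 !mxE.
under [X in - (X + _ + _)]eq_bigr do rewrite !mxE.
have -> : \sum_k A i k * (z (lshift 1 k) 0 - z (lshift 1 i) 0) =
    - \sum_k A i k * (z (lshift 1 i) 0 - z (lshift 1 k) 0).
  by rewrite -sumrN; apply: eq_bigr => k _; ring.
ring.
Qed.

Lemma system_matrix_mul_r d (z : 'cV[R]_(n + 1)) :
  (- (L0 A + H d v) *m z) (rshift n 0) 0 =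
  \sum_k v k 0 * (z (lshift 1 k) 0 - z (rshift n 0) 0).
Proof.
rewrite system_matrixE -{1}[z]vsubmxK mulNmx mul_block_col.
rewrite mul_scalar_mx mxE col_mxEd mulNmx !mxE.
under [X in - (- X + _)]eq_bigr do rewrite !mxE.
under [RHS]eq_bigr do rewrite mulrBr.
by rewrite sumrB -mulr_suml opprD opprK.
Qed.

(** All the terms weighted by entries of A or v push the largest coordinate down
    and the smallest one up. The coupling with the last coordinate supplies the
    rate d: through its two ends if i and j are both at most n, and directly
    if exactly one of them is the last index. *)
Lemma system_contraction d (z : 'cV[R]_(n + 1)) i j : 0 < d ->
  (forall k l, z k 0 - z l 0 <= z i 0 - z j 0) ->
  (- (L0 A + H d v) *m z) i 0 - (- (L0 A + H d v) *m z) j 0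
    <= - d * (z i 0 - z j 0).
Proof.
move=> d0 zij.
have zi k : z k 0 <= z i 0 by have := zij k j; lra.
have zj k : z j 0 <= z k 0 by have := zij i k; lra.
have drop (c : 'I_n -> R) (x : R) : (forall k, 0 <= c k) ->
    (forall k, z k 0 <= x) -> \sum_k c k * (z (lshift 1 k) 0 - x) <= 0.
  by move=> c0 zx; apply: sumr_le0 => k _; rewrite mulr_ge0_le0 ?subr_le0.
have rise (c : 'I_n -> R) (x : R) : (forall k, 0 <= c k) ->
    (forall k, x <= z k 0) -> 0 <= \sum_k c k * (z (lshift 1 k) 0 - x).
  by move=> c0 zx; apply: sumr_ge0 => k _; rewrite mulr_ge0 ?subr_ge0.
case: (split_ordP i) zi {zij} => i' -> zi; case: (split_ordP j) zj => j' -> zj.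
- rewrite !system_matrix_mul_l.
  have := drop (A i') _ (A_ge0 i') zi; have := rise (A j') _ (A_ge0 j') zj; lra.
- rewrite (ord1 j') system_matrix_mul_l system_matrix_mul_r in zj *.
  have := drop (A i') _ (A_ge0 i') zi; have := rise (v^~ 0) _ v_ge0 zj; lra.
- rewrite (ord1 i') system_matrix_mul_l system_matrix_mul_r in zi *.
  have := rise (A j') _ (A_ge0 j') zj; have := drop (v^~ 0) _ v_ge0 zi; lra.
- by rewrite (ord1 i') (ord1 j') !subrr mulr0.
Qed.

Lemma cvg_consensus_weights :
  consensus_weights d @[d --> 0^'+] -->
    row_mx ((s^-1 *: v)^T *m Jbar A) (0 : 'M[R]_1).
Proof.
have s_neq0 : s != 0 by rewrite gt_eqF.
have cvg_sd : (s + d)^-1 @[d --> 0^'+] --> s^-1.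
  apply: cvgV => //; apply: cvg_at_right_filter.
  by rewrite -[X in _ --> X]addr0; apply: cvgD; [exact: cvg_cst|exact: cvg_id].
have cvg_ratio : forest_ratio d @[d --> 0^'+] --> Jbar A.
  apply: cvg_mx_entries => i j; rewrite /forest_ratio.
  under eq_cvg do rewrite !mxE mulrC.
  exact: cvg_normalized_forests.
have -> : row_mx ((s^-1 *: v)^T *m Jbar A) (0 : 'M[R]_1)
    = s^-1 *: row_mx (v^T *m Jbar A) 0.
  by rewrite scale_row_mx scaler0 linearZ /= -scalemxAl.
apply: cvgZ => //; apply: cvg_mx_entries => i j; rewrite ord1.
have cvg_l : v^T *m forest_ratio d @[d --> 0^'+] --> v^T *m Jbar A.
  by apply: cvg_mulmx => //; exact: cvg_cst.
case: (split_ordP j) => k ->.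
  rewrite row_mxEl; under eq_cvg do rewrite row_mxEl.
  exact: (cvg_comp _ _ cvg_l (@coord_continuous R 1 n 0 k (v^T *m Jbar A))).
rewrite row_mxEr mxE; under eq_cvg do rewrite row_mxEr ord1 mxE mulr1n.
by apply: cvg_at_right_filter; exact: cvg_id.
Qed.

End Regularized.

Theorem theorem4p4 (R : realType) (n : nat) (A : 'M[R]_n) (v : 'cV[R]_n)
    (s : R) (y0 : 'cV[R]_(n + 1)) (y : R -> R -> 'cV[R]_(n + 1))
    (A_ge0 : forall i j, 0 <= A i j)
    (v_ge0 : forall i, 0 <= v i 0)
    (sE : s = \sum_i v i 0) (s_gt0 : 0 < s)
    (y_sol : forall delta : R, 0 < delta ->
       solves (- (L0 A + H delta v)) (y delta))
    (y_init : forall delta : R, 0 < delta -> y delta 0 = y0) :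
  iterated_limit y
    ((const_mx 1 : 'cV[R]_(n + 1))
       *m row_mx ((s^-1 *: v)^T *m Jbar A) (0 : 'M[R]_1) *m y0)
  /\
  (v = (s / n%:R) *: const_mx 1 ->
     iterated_limit y
       ((const_mx 1 : 'cV[R]_(n + 1))
          *m row_mx ((n%:R^-1 *: const_mx 1 : 'rV[R]_n) *m Jbar A)
                    (0 : 'M[R]_1) *m y0)
     /\
     (const_mx 1 : 'cV[R]_(n + 1))
       *m row_mx ((n%:R^-1 *: const_mx 1 : 'rV[R]_n) *m Jbar A)
                 (0 : 'M[R]_1) *m y0
     = (n%:R^-1 * \sum_(j < n) (\sum_(i < n) Jbar A i j) * y0 (lshift 1 j) 0)
         *: const_mx 1).
Proof.
have sT : s = Defs.total v by [].
have total_gt0 : 0 < Defs.total v by rewrite -sT.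
have inner d : 0 < d ->
    y d t @[t --> +oo] -->
      (const_mx 1 : 'cV_(n + 1)) *m consensus_weights A v d *m y0.
  move=> d0; rewrite -(y_init d d0).
  apply: (cvg_consensus_value (y_sol d d0) d0).
  - by move=> z i j; exact: system_contraction.
  - exact: consensus_weights_stationary.
  - exact: consensus_weights1.
have limit : iterated_limit y
    ((const_mx 1 : 'cV_(n + 1))
       *m row_mx ((s^-1 *: v)^T *m Jbar A) (0 : 'M[R]_1) *m y0).
  split=> [d d0|]; first by apply/cvg_ex; eexists; exact: inner.
  have : (const_mx 1 : 'cV_(n + 1)) *m consensus_weights A v d *m y0
      @[d --> 0^'+] --> (const_mx 1 : 'cV_(n + 1))
         *m row_mx ((s^-1 *: v)^T *m Jbar A) (0 : 'M[R]_1) *m y0.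
    apply: cvg_mulmx; last exact: cvg_cst.
    apply: cvg_mulmx; first exact: cvg_cst.
    by rewrite sT; exact: cvg_consensus_weights.
  apply: cvg_trans; apply: near_eq_cvg; near=> d; symmetry.
  apply: cvg_lim; first exact: norm_hausdorff.
  by apply: inner; near: d; exact: nbhs_right_gt.
split=> // vE.
have vTE : (s^-1 *: v)^T = n%:R^-1 *: const_mx 1 :> 'rV_n.
  rewrite vE scalerA mulrA mulVf ?gt_eqF // mul1r.
  by apply/matrixP => i j; rewrite !mxE.
rewrite -vTE; split=> //.
rewrite vTE; apply/matrixP => i j; rewrite (ord1 j) {j} -mulmxA.
rewrite -{1}[y0]vsubmxK mul_row_col mul0mx addr0 mxE big_ord1 !mxE mul1r mulr1.
rewrite mulr_sumr; apply: eq_bigr => k _; rewrite !mxE mulrA mulr_sumr.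
by congr (_ * _); apply: eq_bigr => l _; rewrite !mxE mulr1.
Unshelve. all: by end_near. Qed.
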